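(* Let $\mathcal{B}$ be a $C^*$-algebra, let $E,F$ be Hilbert $\mathcal{B}$-modules, and let $c\colon E\to F$ be a right linear contraction (not assumed adjointable). Put $P_c:=\{x\in E\colon\langle cx,cx\rangle=\langle x,x\rangle\}$. (1) If there exists a partial isometry $v\colon E\to F$ contained in $c$, then $v$ is unique and $\pi_v$ is a projection onto $P_c$. (2) If $p_c$ is a projection onto $P_c$, then $v=cp_c$ is a partial isometry, the partial isometry contained in $c$. Summing up, the partial isometry contained in $c$ exists if and only if $P_c$ is complemented in $E$.
   Context: Hilbert $\mathcal{B}$-modules are right modules with $\mathcal{B}$-valued inner product $\langle\cdot,\cdot\rangle$. $P_c$ is a closed submodule of $E$. A projection on $E$ is an adjointable map $p\colon E\to E$ with $p^*p=p$. A closed submodule $E_0\subset E$ is complemented if $E=E_0\oplus E_0^\perp$, equivalently, if there exists a projection on $E$ with range $E_0$. A unitary is a surjective inner product preserving map. A coisometry is a contractive right linear map $E\to F$ between Hilbert $\mathcal{B}$-modules for which there exists a submodule $E'$ of $E$ such that the map restricts to a unitary $E'\to F$. (Coisometries are known to be automatically adjointable, with isometric adjoint.) A map $v\colon E\to F$ between Hilbert $\mathcal{B}$-modules is a partial isometry if it corestricts to a coisometry $v_s\colon E\to vE$ (in particular, $v$ is right linear and contractive and $vE$ is itself a Hilbert $\mathcal{B}$-module, i.e. a closed submodule of $F$). A partial isometry need not be adjointable, but $v_s$ is, with adjoint $v_s^*\colon vE\to E$. The initial projection of $v$ is $\pi_v:=v_s^*v_s$; it is the unique projection on $E$ satisfying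 $v\pi_v=v$ and $(\mathbf{1}-\pi_v)E=\ker v$. A partial isometry $v\colon E\to F$ is said to be contained in the right linear contraction $c\colon E\to F$ if $\langle x,\pi_vx\rangle\le\langle cx,cx\rangle$ for all $x\in E$ and $vx=cx$ for all $x\in P_c$. *)

(* Defs.v *)
From HB Require Import structures.
From mathcomp Require Import all_boot all_order all_algebra.
From mathcomp Require Import all_classical all_reals all_analysis.
From mathcomp Require Import complex.

Set Implicit Arguments.
Unset Strict Implicit.
Unset Printing Implicit Defensive.

Import Order.TTheory GRing.Theory Num.Theory.
Import numFieldNormedType.Exports.

Local Open Scope classical_set_scope.
Local Open Scope ring_scope.

(* The complex numbers are [R[i]] for [R : realType]; norms are therefore
   [R[i]]-valued (with real nonnegative values).  The product is a separate
   operation because the ring structures of MathComp are unital, while a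
   C*-algebra need not have a unit. *)
HB.mixin Record CompleteNormedModule_isCStarAlgebra (R : realType) B
    of CompleteNormedModule R[i] B := {
  csmul : B -> B -> B ;
  csstar : B -> B ;
  csmulA : associative csmul ;
  csmulDl : left_distributive csmul +%R ;
  csmulDr : right_distributive csmul +%R ;
  csmulZl : forall (k : R[i]) (a b : B), csmul (k *: a) b = k *: csmul a b ;
  csmulZr : forall (k : R[i]) (a b : B), csmul a (k *: b) = k *: csmul a b ;
  csnormM : forall a b : B, `|csmul a b| <= `|a| * `|b| ;
  csstarK : involutive csstar ;
  csstarD : {morph csstar : a b / a + b} ;
  csstarZ : forall (k : R[i]) (a : B), csstar (k *: a) = k^* *: csstar a ;
  csstarM : forall a b : B, csstar (csmul a b) = csmul (csstar b) (csstar a) ;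
  csnorm_star : forall a : B, `|csmul (csstar a) a| = `|a| ^+ 2
}.

#[short(type="cstarAlgType")]
HB.structure Definition CStarAlgebra (R : realType) :=
  {B of CompleteNormedModule R[i] B
      & CompleteNormedModule_isCStarAlgebra R B}.

Definition cspos (R : realType) (B : cstarAlgType R) (a : B) : Prop :=
  exists b : B, a = csmul (csstar b) b.

Definition csle (R : realType) (B : cstarAlgType R) (a b : B) : Prop :=
  cspos (b - a).

(* The inner product is linear in its second argument.  [hmnorm] says that the
   norm of the complete normed space [E] is the one of the inner product. *)
HB.mixin Record CompleteNormedModule_isHilbertModule (R : realType)
    (B : cstarAlgType R) E of CompleteNormedModule R[i] E := {
  hmact : E -> B -> E ;
  hmip : E -> E -> B ;
  hmactDl : forall (x y : E) (a : B), hmact (x + y) a = hmact x a + hmact y a ;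
  hmactDr : forall (x : E) (a b : B), hmact x (a + b) = hmact x a + hmact x b ;
  hmactA : forall (x : E) (a b : B), hmact (hmact x a) b = hmact x (csmul a b) ;
  hmactZl : forall (k : R[i]) (x : E) (a : B),
    hmact (k *: x) a = k *: hmact x a ;
  hmactZr : forall (k : R[i]) (x : E) (a : B),
    hmact x (k *: a) = k *: hmact x a ;
  hmipDr : forall x y z : E, hmip x (y + z) = hmip x y + hmip x z ;
  hmipZr : forall (k : R[i]) (x y : E), hmip x (k *: y) = k *: hmip x y ;
  hmip_act : forall (x y : E) (a : B), hmip x (hmact y a) = csmul (hmip x y) a ;
  hmip_star : forall x y : E, csstar (hmip x y) = hmip y x ;
  hmip_pos : forall x : E, cspos (hmip x x) ;
  hmip_def : forall x : E, hmip x x = 0 -> x = 0 ;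
  hmnorm : forall x : E, `|x| ^+ 2 = `|hmip x x|
}.

#[short(type="hilbertModType")]
HB.structure Definition HilbertModule (R : realType) (B : cstarAlgType R) :=
  {E of CompleteNormedModule R[i] E
      & CompleteNormedModule_isHilbertModule R B E}.

Section HilbertModules.
Variables (R : realType) (B : cstarAlgType R).
Implicit Types E F : hilbertModType B.

Definition right_linear E F (f : E -> F) : Prop :=
  linear f /\ forall (x : E) (b : B), f (hmact x b) = hmact (f x) b.

Definition contractive E F (f : E -> F) : Prop :=
  forall x : E, `|f x| <= `|x|.

Definition submodule E (S : set E) : Prop :=
  [/\ S 0,
      forall x y, S x -> S y -> S (x + y),
      forall (k : R[i]) x, S x -> S (k *: x)
    & forall x (b : B), S x -> S (hmact x b)].

Definition closed_submodule E (S : set E) : Prop := submodule S /\ closed S.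

Definition adjoint_pair E F (f : E -> F) (g : F -> E) : Prop :=
  forall x y, hmip (f x) y = hmip x (g y).

Definition projection E (p : E -> E) : Prop :=
  exists2 q : E -> E, adjoint_pair p q & q \o p = p.

Definition projection_onto E (p : E -> E) (S : set E) : Prop :=
  projection p /\ range p = S.

Definition orthocomplement E (S : set E) : set E :=
  [set y | forall x, S x -> hmip x y = 0].

(* Meant for closed submodules [S]; the sum is direct because
   [S `&` orthocomplement S] contains at most 0 by definiteness. *)
Definition complemented E (S : set E) : Prop :=
  forall x : E, exists y z : E, [/\ S y, orthocomplement S z & x = y + z].

(* [f] restricts to a unitary from the submodule [S] onto the submodule [T] *)
Definition restricts_to_unitary E F (S : set E) (T : set F) (f : E -> F) :
  Prop :=
  (forall x y, S x -> S y -> hmip (f x) (f y) = hmip x y) /\ f @` S = T.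

(* Coisometries from [E] to the Hilbert module [T], where [T] is given as a
   closed submodule of [F]; [T = setT] gives the coisometries from [E] to [F]. *)
Definition coisometry E F (T : set F) (f : E -> F) : Prop :=
  [/\ closed_submodule T,
      right_linear f,
      contractive f,
      forall x, T (f x)
    & exists2 S : set E, submodule S & restricts_to_unitary S T f].

Definition partial_isometry E F (v : E -> F) : Prop := coisometry (range v) v.

(* The adjoint [range v -> E] of the corestriction [E -> range v] of [v]; only
   its values on [range v] are meaningful.  When [v] is a partial isometry, the
   adjoint exists and is unique, so the default value 0 is not used there. *)
Definition corestriction_adjoint E F (v : E -> F) (y : F) : E :=
  xget 0 [set z | forall x, hmip (v x) y = hmip x z].

Definition initial_projection E F (v : E -> F) : E -> E :=
  corestriction_adjoint v \o v.

(* The set P_c; it is a closed submodule when [c] is a right linear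
   contraction. *)
Definition isometric_part E F (c : E -> F) : set E :=
  [set x | hmip (c x) (c x) = hmip x x].

Definition contained_in E F (v c : E -> F) : Prop :=
  (forall x, csle (hmip x (initial_projection v x)) (hmip (c x) (c x))) /\
  (forall x, isometric_part c x -> v x = c x).

Definition contained_partial_isometry E F (c v : E -> F) : Prop :=
  partial_isometry v /\ contained_in v c.

End HilbertModules.

(* Main.v *)
(* Everything rests on one property of a right linear contraction c: if
   <cy,cy> = <y,y>, then <cy,cz> = <y,z> for all z.  For G = <y,z> - <cy,cz> and
   w = z - s y G, s > 0, one has <cw,cw> = <w,w> + 2s G^* G - (<z,z> - <cz,cz>),
   and the norm inequality |c(wa)| <= |wa| for all a in B forces G = 0 as s grows.
   Applied to a partial isometry v, the property gives <vx,vy> = <x,pi_v y>;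
   applied to c, it gives <cx,cx> - <x,px> = <cz,cz> for z = x - px.

   The passage from norm inequalities to order needs that the elements g^* g are
   positive.  They act by left multiplication on B, and positivity is studied in
   the algebra of bounded adjointable operators on B, which has a unit even when
   B has none; an operator T is positive when it is self-adjoint and |r - T| <= r
   for some r.  Square roots, obtained as limits of the iteration
   s <- (X + s^2)/2, are the only functional calculus needed. *)

Require Import Defs.
From HB Require Import structures.
From mathcomp Require Import all_boot all_order all_algebra.
From mathcomp Require Import all_classical all_reals all_analysis.
From mathcomp Require Import complex ring lra.
From Stdlib Require Ncring Ncring_tac.

Set Implicit Arguments.
Unset Strict Implicit.
Unset Printing Implicit Defensive.

Import Order.TTheory GRing.Theory Num.Theory.
Import numFieldNormedType.Exports.

Local Open Scope classical_set_scope.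
Local Open Scope ring_scope.

Local Notation "r %:C" := (real_complex _ r) : ring_scope.

(** * Real-valued norms *)

Section RealNorm.
Variables (R : realType) (V : normedModType R[i]).
Implicit Types (x y : V) (r : R).

(** Norms over [R[i]] are complex-valued; their real parts live in the ordered field [R], where
    [lra] and [nra] apply. *)
Definition nrm x : R := complex.Re `|x|.

Lemma nrmE x : `|x| = (nrm x)%:C.
Proof. by rewrite RRe_real// normr_real. Qed.

Lemma nrm_ge0 x : 0 <= nrm x.
Proof. by rewrite -ler0c -nrmE. Qed.

Lemma nrm0 : nrm 0 = 0.
Proof. by rewrite /nrm normr0. Qed.

Lemma nrm_eq0 x : nrm x = 0 -> x = 0.
Proof. by move=> x0; apply/eqP; rewrite -normr_eq0 nrmE x0. Qed.

Lemma nrmN x : nrm (- x) = nrm x.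
Proof. by rewrite /nrm normrN. Qed.

Lemma nrmD x y : nrm (x + y) <= nrm x + nrm y.
Proof. by rewrite -lecR rmorphD /= -!nrmE ler_normD. Qed.

Lemma nrmZ r x : nrm (r%:C *: x) = `|r| * nrm x.
Proof.
apply: complexI; rewrite rmorphM /= -!nrmE normrZ normc_def /= expr0n /=.
by rewrite addr0 sqrtr_sqr.
Qed.

Lemma nrm_small x (K : R) : (forall e, 0 < e -> nrm x <= e * K) -> x = 0.
Proof.
move=> xK; apply: nrm_eq0; apply/eqP; rewrite eq_le nrm_ge0 andbT.
apply/ler_addgt0Pl => e e0; rewrite addr0.
have K1 : 0 < `|K| + 1 by rewrite ltr_wpDl.
have {xK} := xK (e / (`|K| + 1)) (divr_gt0 e0 K1).
move=> /le_trans; apply; rewrite -mulrA ler_piMr ?(ltW e0)//.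
rewrite mulrC ler_pdivrMr// mul1r.
by rewrite (le_trans (ler_norm K))// lerDl.
Qed.

End RealNorm.

Lemma small_invS (R : realType) (e : R) : 0 < e -> exists n : nat, 2 / n.+2%:R < e.
Proof.
move=> e0; have [n _ nP] := near_infty_natSinv_lt (PosNum (divr_gt0 e0 (ltr0Sn R 1))).
exists n; have := nP n (leqnn n); rewrite /= => ne.
rewrite -[e](@divfK _ 2)// mulrC ltr_pM2r// (le_lt_trans _ ne)//.
by rewrite lef_pV2 ?posrE ?ler_nat.
Qed.

(** Completeness with a rate that survives in the limit. For pointwise limits of operators the
    factor [K] is [nrm x], which makes the convergence uniform; 2/(n+2) is the rate of the scalar
    square root iteration. *)
Lemma complete_lim (R : realType) (V : completeNormedModType R[i])
    (u : nat -> V) (K : R) :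
    (forall m n, (n <= m)%N -> nrm (u m - u n) <= 2 / n.+2%:R * K) ->
  exists l, forall n, nrm (l - u n) <= 2 / n.+2%:R * K.
Proof.
move=> uC.
have sm e : 0 < e -> exists n, 2 / n.+2%:R * K < e.
  move=> e0; have K1 : 0 < `|K| + 1 by rewrite ltr_wpDl.
  have [n nP] := small_invS (divr_gt0 e0 K1); exists n.
  rewrite (le_lt_trans (ler_norm _))// normrM ger0_norm//.
  rewrite (@le_lt_trans _ _ (2 / n.+2%:R * (`|K| + 1)))// ?ler_wpM2l ?lerDl//.
  by rewrite -ltr_pdivlMr.
have /cauchy_cvgP ucvg : cauchy (u @ \oo).
  apply/cauchy_ballP => e e0.
  have eR : e = (complex.Re e)%:C by rewrite RRe_real// gtr0_real.
  have {}e0 : 0 < complex.Re e by rewrite -ltcR -eR.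
  have [n nP] : exists n, 2 / n.+2%:R * K < complex.Re e / 2 by apply: sm; rewrite divr_gt0.
  exists ([set y | exists2 m, (n <= m)%N & y = u m],
          [set y | exists2 m, (n <= m)%N & y = u m]).
    by split; exists n => // m /= nm; exists m.
  move=> [_ _] /= [[m nm ->] [k nk ->]]; rewrite -ball_normE /ball_ /= nrmE eR ltcR.
  have -> : u m - u k = (u m - u n) - (u k - u n) by rewrite opprB addrA subrK.
  have := nrmD (u m - u n) (- (u k - u n)); rewrite nrmN.
  move: (uC _ _ nm) (uC _ _ nk) nP.
  move: (nrm _) (nrm _) (nrm _) (_ * K) => a b c d; lra.
exists (lim (u @ \oo)) => n; apply/ler_addgt0Pr => e e0.
have e0C : 0 < e%:C :> R[i] by rewrite -(rmorph0 (real_complex R)) ltcR.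
have /cvgrPdist_lt/(_ _ e0C)[N _ NP] := ucvg.
(* An index beyond [N] for closeness to the limit and beyond [n] for the hypothesis. *)
have := NP (maxn N n) (leq_maxl _ _); rewrite /= nrmE ltcR => lm.
have := uC _ _ (leq_maxr N n) => mn.
have -> : lim (u @ \oo) - u n = (lim (u @ \oo) - u (maxn N n)) + (u (maxn N n) - u n).
  by rewrite addrA subrK.
by rewrite (le_trans (nrmD _ _))// addrC lerD// ltW.
Qed.

(** * Adjointable operators on a C-star algebra *)

Section CStarBasics.
Variables (R : realType) (B : cstarAlgType R).
Implicit Types a b x y z : B.

Lemma csmul0 a : csmul a 0 = 0.
Proof. by apply: (addrI (csmul a 0)); rewrite -csmulDr !addr0. Qed.

Lemma csmul0l a : csmul 0 a = 0.
Proof. by apply: (addrI (csmul 0 a)); rewrite -csmulDl !addr0. Qed.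

Lemma csmulN a b : csmul a (- b) = - csmul a b.
Proof. by apply/eqP; rewrite -addr_eq0 -csmulDr addNr csmul0. Qed.

Lemma csstar0 : csstar (0 : B) = 0.
Proof. by apply: (addrI (csstar 0)); rewrite -csstarD !addr0. Qed.

Lemma csstarN a : csstar (- a) = - csstar a.
Proof. by apply/eqP; rewrite -addr_eq0 -csstarD addNr csstar0. Qed.

(** The inner product of [B] as a Hilbert module over itself. *)
Definition bip a b : B := csmul (csstar a) b.

Lemma bipDr a b c : bip a (b + c) = bip a b + bip a c.
Proof. exact: csmulDr. Qed.

Lemma bipNr a b : bip a (- b) = - bip a b.
Proof. exact: csmulN. Qed.

Lemma bipZr (k : R[i]) a b : bip a (k *: b) = k *: bip a b.
Proof. exact: csmulZr. Qed.

Lemma csstar_bip a b : csstar (bip a b) = bip b a.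
Proof. by rewrite /bip csstarM csstarK. Qed.

Lemma bipDl a b c : bip (b + c) a = bip b a + bip c a.
Proof. by rewrite -csstar_bip bipDr csstarD !csstar_bip. Qed.

Lemma bipNl a b : bip (- b) a = - bip b a.
Proof. by rewrite -csstar_bip bipNr csstarN !csstar_bip. Qed.

Lemma nrm_bip a : nrm (bip a a) = nrm a ^+ 2.
Proof. by apply: complexI; rewrite rmorphXn /= -!nrmE csnorm_star. Qed.

Lemma nrm_csmul a b : nrm (csmul a b) <= nrm a * nrm b.
Proof. by rewrite -lecR rmorphM /= -!nrmE csnormM. Qed.

Lemma bip_eq0 a : bip a a = 0 -> a = 0.
Proof.
move=> a0; have /eqP : nrm a ^+ 2 = 0 by rewrite -nrm_bip a0 nrm0.
by rewrite expf_eq0 => /eqP/nrm_eq0.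
Qed.

(** The C-star identity gives [|b|^2 = |b^* b| <= |b^*| |b|], used for [a] and for its adjoint. *)
Lemma nrm_csstar a : nrm (csstar a) = nrm a.
Proof.
suff le b : nrm b <= nrm (csstar b).
  by apply/eqP; rewrite eq_le -{2}[a]csstarK !le.
have [->|b0] := eqVneq (nrm b) 0; first exact: nrm_ge0.
have b1 : 0 < nrm b by rewrite lt_def b0 nrm_ge0.
by rewrite -(ler_pM2r b1) -expr2 -nrm_bip nrm_csmul.
Qed.

Lemma nrm_bip_le a b : nrm (bip a b) <= nrm a * nrm b.
Proof. by rewrite -(nrm_csstar a) nrm_csmul. Qed.

Definition adj (f g : B -> B) := forall x y, bip (f x) y = bip x (g y).

Lemma bip_injr y z : (forall x, bip x y = bip x z) -> y = z.
Proof.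
move=> yz; apply/eqP; rewrite -subr_eq0; apply/eqP/bip_eq0.
by rewrite bipDr bipNr yz subrr.
Qed.

Lemma adj_sym f g : adj f g -> adj g f.
Proof. by move=> fg x y; rewrite -csstar_bip -fg csstar_bip. Qed.

Lemma adj_linear f g : adj f g -> linear f.
Proof.
move=> /adj_sym gf k x y; apply: bip_injr => z.
by rewrite bipDr bipZr -!gf bipDr bipZr.
Qed.

Definition bounded_by (M : R) (f : B -> B) := forall x, nrm (f x) <= M * nrm x.

Lemma le_bounded_by (M N : R) f : M <= N -> bounded_by M f -> bounded_by N f.
Proof. by move=> MN fM x; rewrite (le_trans (fM x))// ler_wpM2r ?nrm_ge0. Qed.

(** [|g x|^2 = |<f (g x), x>| <= M |g x| |x|]. *)
Lemma bounded_by_adj (M : R) f g : 0 <= M -> adj f g -> bounded_by M f ->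
  bounded_by M g.
Proof.
move=> M0 fg fM x; have [->|gx0] := eqVneq (nrm (g x)) 0.
  by rewrite mulr_ge0 ?nrm_ge0.
have gx1 : 0 < nrm (g x) by rewrite lt_def gx0 nrm_ge0.
rewrite -(ler_pM2r gx1) -expr2 -nrm_bip -fg (le_trans (nrm_bip_le _ _))//.
by rewrite [leRHS]mulrAC ler_wpM2r ?nrm_ge0.
Qed.

(** Linearity comes from the adjoint, by [adj_linear]. As a boolean predicate it lets [op] inherit
    the module structure of the functions [B -> B]. *)
Definition op_pred : {pred B -> B} := fun f =>
  `[< (exists g, adj f g) /\ exists2 M, 0 <= M & bounded_by M f >].

Lemma op_predP f : reflect
  ((exists g, adj f g) /\ exists2 M, 0 <= M & bounded_by M f) (f \in op_pred).
Proof. exact: asboolP. Qed.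

Lemma op_submod_closed : submod_closed op_pred.
Proof.
split=> [|k f h /op_predP[[f' ff'] [M M0 fM]] /op_predP[[h' hh'] [N N0 hN]]].
  apply/op_predP; split.
    by exists (fun=> 0) => x y; rewrite /bip csstar0 csmul0 csmul0l.
  by exists 0 => // x; rewrite /= nrm0 mul0r.
apply/op_predP; split.
  exists (k^* *: f' + h') => x y.
  by rewrite bipDl bipDr bipZr -ff' -hh' /bip csstarZ csmulZl.
have kE : `|k| = (complex.Re `|k|)%:C by rewrite RRe_real// normr_real.
have k0 : 0 <= complex.Re `|k| by rewrite -ler0c -kE.
exists (complex.Re `|k| * M + N); first by rewrite addr_ge0// mulr_ge0.
move=> x; rewrite (le_trans (nrmD _ _))// mulrDl lerD// -mulrA.
rewrite -lecR -nrmE normrZ rmorphM /= -kE ler_wpM2l// nrmE lecR.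
exact: fM.
Qed.

End CStarBasics.

(** * The unital ring of adjointable operators *)

Record op (R : realType) (B : cstarAlgType R) :=
  Op { op_fun :> B -> B ; op_funP : op_fun \in @op_pred R B }.
Arguments Op {R B}.

HB.instance Definition _ (R : realType) (B : cstarAlgType R) :=
  [isSub for @op_fun R B].
HB.instance Definition _ (R : realType) (B : cstarAlgType R) :=
  [Choice of op B by <:].
HB.instance Definition _ (R : realType) (B : cstarAlgType R) :=
  GRing.SubChoice_isSubLmodule.Build R[i] (B -> B) (@op_pred R B) (op B)
    (GRing.submod_closed_semi (@op_submod_closed R B)).

Section OpRing.
Variables (R : realType) (B : cstarAlgType R).
Implicit Types (f g h : op B) (x y : B).

Lemma op_eqP f g : f = g <-> f =1 g.
Proof. by split=> [->//|fg]; apply/val_inj/funext. Qed.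

Lemma op_linear f : linear f.
Proof. by have /op_predP[[g /adj_linear]] := op_funP f. Qed.

HB.instance Definition _ f := GRing.isLinear.Build R[i] B B *:%R f (op_linear f).

Lemma op_bounded f : exists2 M, 0 <= M & bounded_by M f.
Proof. by have /op_predP[] := op_funP f. Qed.

Lemma op_id_subproof : idfun \in @op_pred R B.
Proof.
by apply/op_predP; split; [exists idfun | exists 1 => // x; rewrite mul1r].
Qed.

Lemma op_comp_subproof f g : f \o g \in @op_pred R B.
Proof.
have /op_predP[[f' ff'] [M M0 fM]] := op_funP f.
have /op_predP[[g' gg'] [N N0 gN]] := op_funP g.
apply/op_predP; split; first by exists (g' \o f') => x y; rewrite /= ff' gg'.
exists (M * N) => [|x]; first exact: mulr_ge0.
by rewrite (le_trans (fM _))// -mulrA ler_wpM2l.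
Qed.

Let mul f g := Op _ (op_comp_subproof f g).

Fact op_mulA : associative mul.
Proof. by move=> f g h; apply/op_eqP. Qed.
Fact op_mul1 : left_id (Op _ op_id_subproof) mul.
Proof. by move=> f; apply/op_eqP. Qed.
Fact op_1mul : right_id (Op _ op_id_subproof) mul.
Proof. by move=> f; apply/op_eqP. Qed.
Fact op_mulDl : left_distributive mul +%R.
Proof. by move=> f g h; apply/op_eqP. Qed.
Fact op_mulDr : right_distributive mul +%R.
Proof. by move=> f g h; apply/op_eqP => x /=; exact: raddfD. Qed.

(** Only a possibly zero ring, since [B] may be 0. *)
HB.instance Definition _ :=
  GRing.Zmodule_isPzRing.Build (op B) op_mulA op_mul1 op_1mul op_mulDl op_mulDr.

Lemma op1E x : (1 : op B) x = x. Proof. by []. Qed.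
Lemma opME f g x : (f * g) x = f (g x). Proof. by []. Qed.
Lemma opDE f g x : (f + g) x = f x + g x. Proof. by []. Qed.
Lemma opNE f x : (- f) x = - f x. Proof. by []. Qed.
Lemma op0E x : (0 : op B) x = 0. Proof. by []. Qed.
Lemma opZE (k : R[i]) f x : (k *: f) x = k *: f x. Proof. by []. Qed.
Definition opE := (op1E, opME, opDE, opNE, op0E, opZE).

Lemma opZl (k : R[i]) f g : (k *: f) * g = k *: (f * g).
Proof. by apply/op_eqP. Qed.

Lemma opZr (k : R[i]) f g : f * (k *: g) = k *: (f * g).
Proof. by apply/op_eqP => x; rewrite !opE linearZ. Qed.

(** The adjoint is picked by choice; [op_star_uniq] identifies it and yields all the rules for
    [op_star]. *)
Lemma op_star_subproof f : {g | adj f g}.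
Proof. by apply: cid; have /op_predP[] := op_funP f. Qed.

Lemma op_star_proof f : sval (op_star_subproof f) \in @op_pred R B.
Proof.
case: op_star_subproof => g /= fg; apply/op_predP; split.
  by exists f; exact: adj_sym.
by have [M M0 fM] := op_bounded f; exists M => //; exact: bounded_by_adj fM.
Qed.

Definition op_star f := Op _ (op_star_proof f).

Lemma op_starE f x y : bip (f x) y = bip x (op_star f y).
Proof. by rewrite /= (svalP (op_star_subproof f)). Qed.

Lemma op_star_uniq f g : adj f g -> op_star f = g.
Proof.
by move=> fg; apply/op_eqP => x; apply: bip_injr => y; rewrite -op_starE fg.
Qed.

Lemma op_starK : involutive op_star.
Proof. by move=> f; apply/op_star_uniq/adj_sym/op_starE. Qed.

Lemma op_starM f g : op_star (f * g) = op_star g * op_star f.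
Proof. by apply: op_star_uniq => x y; rewrite !opE !op_starE. Qed.

Lemma op_starD f g : op_star (f + g) = op_star f + op_star g.
Proof. by apply: op_star_uniq => x y; rewrite !opE bipDl bipDr !op_starE. Qed.

Lemma op_starN f : op_star (- f) = - op_star f.
Proof. by apply: op_star_uniq => x y; rewrite !opE bipNl bipNr !op_starE. Qed.

Lemma op_starZ (k : R[i]) f : op_star (k *: f) = k^* *: op_star f.
Proof.
by apply: op_star_uniq => x y; rewrite !opE bipZr -op_starE /bip csstarZ csmulZl.
Qed.

Lemma op_star1 : op_star 1 = 1.
Proof. exact: op_star_uniq. Qed.

Definition lmul (a : B) : B -> B := csmul a.

Lemma lmul_subproof a : lmul a \in @op_pred R B.
Proof.
apply/op_predP; split; last first.
  by exists (nrm a) => [|x]; rewrite ?nrm_ge0// nrm_csmul.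
by exists (lmul (csstar a)) => x y; rewrite /bip csstarM csmulA.
Qed.

Definition Lop a := Op _ (lmul_subproof a).

Lemma op_starL a : op_star (Lop a) = Lop (csstar a).
Proof. by apply: op_star_uniq => x y; rewrite /bip csstarM csmulA. Qed.

End OpRing.

(** * Noncommutative ring identities by reflection *)

Section NoncommutativeRing.
Variable A : pzRingType.
Definition nc_ops : @Ncring.Ring_ops A 0 1 +%R *%R (fun x y => x - y) -%R eq.
Proof. by constructor. Defined.
Lemma nc_ring_axioms : @Ncring.Ring A _ _ _ _ _ _ _ nc_ops.
Proof.
constructor; rewrite /Algebra_syntax.addition /Algebra_syntax.multiplication
  /Algebra_syntax.subtraction /Algebra_syntax.opposite /Algebra_syntax.zero
  /Algebra_syntax.one /Algebra_syntax.equality /=.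
- exact: RelationClasses.eq_equivalence.
- by move=> ? ? -> ? ? ->.
- by move=> ? ? -> ? ? ->.
- by move=> ? ? -> ? ? ->.
- by move=> ? ? ->.
- exact: add0r.
- exact: addrC.
- exact: addrA.
- exact: mul1r.
- exact: mulr1.
- exact: mulrA.
- exact: mulrDl.
- move=> *; exact: mulrDr.
- by [].
- exact: subrr.
Qed.
End NoncommutativeRing.
Existing Instances nc_ops nc_ring_axioms.

Ltac nc_ring := Ncring_tac.non_commutative_ring.

(** * Operator bounds and square roots *)

Section OpBounds.
Variables (R : realType) (B : cstarAlgType R).
Implicit Types (f g h : op B) (x y : B) (M N K r e : R).

Notation bd := (@bounded_by R B).

Lemma bdD M N f g : bd M f -> bd N g -> bd (M + N) (f + g).
Proof. by move=> fM gN x; rewrite opE (le_trans (nrmD _ _))// mulrDl lerD. Qed.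

Lemma bdN M f : bd M f -> bd M (- f).
Proof. by move=> fM x; rewrite opE nrmN. Qed.

Lemma bdB M N f g : bd M f -> bd N g -> bd (M + N) (f - g).
Proof. by move=> fM gN; apply: bdD => //; exact: bdN. Qed.

Lemma bdM M N f g : 0 <= M -> bd M f -> bd N g -> bd (M * N) (f * g).
Proof.
by move=> M0 fM gN x; rewrite opE (le_trans (fM _))// -mulrA ler_wpM2l.
Qed.

Lemma bdZ M f r : bd M f -> bd (`|r| * M) (r%:C *: f).
Proof. by move=> fM x; rewrite opE nrmZ -mulrA ler_wpM2l. Qed.

Lemma bd1 : bd 1 (1 : op B).
Proof. by move=> x; rewrite mul1r. Qed.

Lemma bd_scal r : 0 <= r -> bd r (r%:C *: (1 : op B)).
Proof. by move=> r0 x; rewrite !opE nrmZ ger0_norm. Qed.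

Lemma bd_double M f : bd (M + M) (f + f) -> bd M f.
Proof.
move=> fM x; have := fM x; rewrite opE.
have -> : f x + f x = (1 + 1 : R)%:C *: f x by rewrite rmorphD scalerDl scale1r.
by rewrite nrmZ ger0_norm// -[_ + _]/(2 : R); lra.
Qed.

Lemma bd_star M f : 0 <= M -> bd M f -> bd M (op_star f).
Proof. by move=> M0; apply: bounded_by_adj => // x y; rewrite op_starE. Qed.

(** [|f x|^2 = |<x, f^* f x>| <= M^2 |x|^2]. *)
Lemma bd_starM M f : 0 <= M -> bd (M ^+ 2) (op_star f * f) -> bd M f.
Proof.
move=> M0 ffM x; rewrite -(ler_pXn2r (ltn0Sn 1)) ?nnegrE ?mulr_ge0 ?nrm_ge0//.
rewrite -nrm_bip op_starE (le_trans (nrm_bip_le _ _))//.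
by rewrite exprMn [leRHS]mulrC expr2 -mulrA ler_wpM2l ?nrm_ge0// mulrC ffM.
Qed.

Lemma bd_small K f : (forall e, 0 < e -> bd (e * K) f) -> f = 0.
Proof.
move=> fK; apply/op_eqP => x; apply: (nrm_small (K := K * nrm x)) => e e0.
by rewrite mulrA fK.
Qed.

Lemma bd0 f : bd 0 f -> f = 0.
Proof. by move=> f0; apply: (bd_small (K := 0)) => e _; rewrite mulr0. Qed.

Lemma bd_closed M f : (forall e, 0 < e -> bd (M + e) f) -> bd M f.
Proof.
move=> fM x; apply/ler_addgt0Pr => e e0.
have n0 : 0 < nrm x + 1 by rewrite ltr_wpDl ?nrm_ge0.
rewrite (le_trans (fM _ (divr_gt0 e0 n0) x))// mulrDl lerD2l -mulrA.
by rewrite ler_piMr ?(ltW e0)// mulrC ler_pdivrMr// mul1r lerDl.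
Qed.

(** Takes the place of an operator norm: a bound that can always be multiplied by [t < 1] can be
    iterated down to 0. *)
Lemma bd_shrink (t : R) f : 0 <= t -> t < 1 ->
  (forall M, 0 <= M -> bd M f -> bd (t * M) f) -> f = 0.
Proof.
move=> t0 t1 ft; have [M M0 fM] := op_bounded f.
have ftn n : bd (t ^+ n * M) f.
  elim: n => [|n IH]; first by rewrite mul1r.
  by rewrite exprS -mulrA; apply: ft => //; rewrite mulr_ge0 ?exprn_ge0.
apply: (bd_small (K := M)) => e e0.
have tn1 : `|t| < 1 by rewrite ger0_norm.
have /cvgrPdist_lt/(_ _ e0)[n _ /(_ n (leqnn n))] := cvg_expr tn1.
rewrite /= sub0r normrN ger0_norm ?exprn_ge0// => tne.
by apply: le_bounded_by (ftn n); rewrite ler_wpM2r// ltW.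
Qed.

Definition selfadj f := op_star f = f.

Lemma selfadj1 : selfadj (1 : op B). Proof. exact: op_star1. Qed.
Lemma selfadj0 : selfadj (0 : op B).
Proof. by rewrite /selfadj -(subrr 1) op_starD op_starN op_star1. Qed.
Lemma selfadjD f g : selfadj f -> selfadj g -> selfadj (f + g).
Proof. by rewrite /selfadj op_starD => -> ->. Qed.
Lemma selfadjN f : selfadj f -> selfadj (- f).
Proof. by rewrite /selfadj op_starN => ->. Qed.
Lemma selfadjB f g : selfadj f -> selfadj g -> selfadj (f - g).
Proof. by move=> ? ?; apply/selfadjD => //; exact: selfadjN. Qed.
Lemma selfadjM f g : selfadj f -> selfadj g -> GRing.comm f g -> selfadj (f * g).
Proof. by rewrite /selfadj op_starM => -> -> ->. Qed.
Lemma selfadjZ r f : selfadj f -> selfadj (r%:C *: f).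
Proof. by rewrite /selfadj op_starZ => ->; rewrite conj_Creal ?complex_real. Qed.
Lemma selfadj_starM f : selfadj (op_star f * f).
Proof. by rewrite /selfadj op_starM op_starK. Qed.

Lemma commZ (k : R[i]) f g : GRing.comm f g -> GRing.comm f (k *: g).
Proof. by rewrite /GRing.comm opZl opZr => ->. Qed.

(** The limit is taken pointwise. Self-adjointness of the terms passes to it, and so the limit is
    its own adjoint. *)
Lemma op_complete (s : nat -> op B) : (forall n, selfadj (s n)) ->
    (forall m n, (n <= m)%N -> bd (2 / n.+2%:R) (s m - s n)) ->
  exists S : op B, forall n, bd (2 / n.+2%:R) (S - s n).
Proof.
move=> ss sC.
have [S SP] : {S : B -> B & forall x n, nrm (S x - s n x) <= 2 / n.+2%:R * nrm x}.
  apply: (@choice _ _ (fun x l => forall n, nrm (l - s n x) <= 2 / n.+2%:R * nrm x)) => x.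
  by apply: complete_lim => m n nm; exact: sC.
suff SO : S \in @op_pred R B by exists (Op _ SO) => n x; exact: SP.
apply/op_predP; split; last first.
  have [M M0 sM] := op_bounded (s 0%N).
  exists (1 + M) => [|x]; first by rewrite addr_ge0.
  have -> : S x = (S x - s 0%N x) + s 0%N x by rewrite subrK.
  rewrite mulrDl (le_trans (nrmD _ _))// lerD// (le_trans (SP _ _))//.
  by rewrite divff.
exists S => x y; apply/eqP; rewrite -subr_eq0; apply/eqP.
apply: (nrm_small (K := nrm x * nrm y + nrm x * nrm y)) => e e0.
have [n /ltW ne] := small_invS e0.
have -> : bip (S x) y - bip x (S y) = bip (S x - s n x) y - bip x (S y - s n y).
  rewrite bipDl bipDr bipNl bipNr op_starE ss.
  by rewrite opprB [RHS]addrA subrK.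
rewrite (le_trans (nrmD _ _))// mulrDr nrmN lerD//.
  rewrite (le_trans (nrm_bip_le _ _))// mulrA ler_wpM2r ?nrm_ge0//.
  by rewrite (le_trans (SP _ n))// ler_wpM2r ?nrm_ge0.
rewrite (le_trans (nrm_bip_le _ _))// mulrCA ler_wpM2l ?nrm_ge0//.
by rewrite (le_trans (SP _ n))// ler_wpM2r ?nrm_ge0.
Qed.

Lemma bd_seq_small K f : 0 <= K -> (forall n : nat, bd (2 / n.+2%:R * K) f) -> f = 0.
Proof.
move=> K0 fK; apply: (bd_small (K := K)) => e e0; have [n /ltW ne] := small_invS e0.
by apply: le_bounded_by (fK n); rewrite ler_wpM2r.
Qed.

(* The iteration s <- (X + s^2)/2, dominated by its scalar version t_n, for
   which 1 - t_n <= 2/(n+2). *)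
Lemma sqrt_iteration (X : op B) : selfadj X -> bd 1 X ->
  exists s, [/\ selfadj s, bd 1 s, X + s * s = s + s &
    forall Y, GRing.comm Y X -> GRing.comm Y s].
Proof.
move=> Xs X1; pose s n := iter n (fun s => (2^-1 : R)%:C *: (X + s * s)) 0.
pose t n : R := iter n (fun t => (1 + t * t) / 2) 0.
have sS n : s n.+1 + s n.+1 = X + s n * s n.
  rewrite /s iterS -scalerDl -rmorphD /= (_ : 2^-1 + 2^-1 = 1) ?scale1r//.
  by rewrite [RHS]splitr mul1r.
have tS n : t n.+1 + t n.+1 = 1 + t n * t n by rewrite /t iterS -splitr.
have t01 n : 0 <= t n /\ t n <= 1.
  by elim: n => [|n [t0 t1]]; [split | have := tS n; nra].
(* The increment is [(1 - t n)^2 / 2]. *)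
have tm n : t n <= t n.+1 by have := tS n; have := sqr_ge0 (1 - t n); rewrite expr2; nra.
have tmon m n : (n <= m)%N -> t n <= t m.
  by move=> nm; apply: (@nondecreasing_seqP _ _ t).1.
have trate n : 1 - t n <= 2 / n.+2%:R.
  elim: n => [|n IH]; first by rewrite subr0 divff.
  have := tS n; have [t0 t1] := t01 n; move: IH; rewrite !ler_pdivlMr//.
  rewrite -(natr1 n.+2); have : 2 <= n.+2%:R :> R by rewrite ler_nat.
  move: (n.+2%:R : R) (t n) (t n.+1) t0 t1 => b u v t0 t1 b2 ih uv.
  have b0 : 0 < b * b by nra.
  (* The induction hypothesis reads [q <= 2], and [1 - v = (1 - u) - (1 - u)^2 / 2] grows with
     [1 - u]; [h] compares with the value at [q = 2]. *)
  pose q := (1 - u) * b; have q0 : 0 <= q by rewrite mulr_ge0//; lra.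
  have h : 2 * b * q - q * q <= 4 * b - 4.
    suff : 0 <= (2 - q) * (2 * b - 2 - q) by lra.
    by apply: mulr_ge0; rewrite /q; lra.
  have vE : v = (1 + u * u) / 2 by lra.
  rewrite -(ler_pM2r b0).
  have -> : (1 - v) * (b + 1) * (b * b) = (b + 1) * (2 * b * q - q * q) / 2.
    by rewrite vE /q; field.
  nra.
have scomm n Y : GRing.comm Y X -> GRing.comm Y (s n).
  move=> YX; elim: n => [|n IH]; first exact: commr0.
  by apply/commZ/commrD => //; exact: commrM.
have ssa n : selfadj (s n).
  elim: n => [|n IH]; first exact: selfadj0.
  by apply: selfadjZ; apply: selfadjD => //; apply: selfadjM => //.
have sb n : bd (t n) (s n).
  elim: n => [|n IH]; first by move=> x; rewrite nrm0 mul0r.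
  apply: bd_double; rewrite sS tS; apply: bdD => //; apply: bdM => //.
  by have [] := t01 n.
(* Twice the next increment is [s' (s' - s) + (s' - s) s] for consecutive terms [s] and [s'],
   without any commutation; the scalars [t] satisfy the same recursion, so bounds carry over. *)
have sd n : bd (t n.+1 - t n) (s n.+1 - s n).
  elim: n => [|n IH].
    by apply: bd_double; rewrite !subr0 sS tS !mulr0 !addr0.
  apply: bd_double.
  have -> : s n.+2 - s n.+1 + (s n.+2 - s n.+1)
      = s n.+1 * (s n.+1 - s n) + (s n.+1 - s n) * s n.
    rewrite addrACA sS -opprD sS mulrBr mulrBl addrA subrK.
    by rewrite opprD addrACA subrr add0r.
  have -> : t n.+2 - t n.+1 + (t n.+2 - t n.+1)
      = t n.+1 * (t n.+1 - t n) + (t n.+1 - t n) * t n.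
    by have := tS n; have := tS n.+1; lra.
  have [tn0 _] := t01 n.+1; apply: bdD; apply: bdM => //.
  by rewrite subr_ge0.
have sC m n : (n <= m)%N -> bd (2 / n.+2%:R) (s m - s n).
  move=> nm; apply: (@le_bounded_by _ _ (t m - t n)).
    have [_ tm1] := t01 m; rewrite (le_trans _ (trate n))//.
    by rewrite lerD2r.
  move: nm; elim: m => [|m IH].
    by rewrite leqn0 => /eqP->; rewrite !subrr => x; rewrite nrm0 mul0r.
  rewrite leq_eqVlt ltnS => /orP[/eqP<-|/IH nm].
    by rewrite !subrr => x; rewrite nrm0 mul0r.
  have -> : t m.+1 - t n = (t m.+1 - t m) + (t m - t n) by rewrite addrA subrK.
  have -> : s m.+1 - s n = (s m.+1 - s m) + (s m - s n) by rewrite addrA subrK.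
  exact: bdD.
have [S SP] := op_complete ssa sC.
have d0 n : 0 <= 2 / n.+2%:R :> R by [].
have dS n : 2 / n.+3%:R <= 2 / n.+2%:R :> R.
  by rewrite ler_pM2l// lef_pV2 ?posrE// ler_nat.
have SC Y : GRing.comm Y X -> GRing.comm Y S.
  move=> YX; have [M M0 YM] := op_bounded Y.
  apply/eqP; rewrite -subr_eq0; apply/eqP.
  apply: (@bd_seq_small (M + M)) => [|n]; first exact: addr_ge0.
  have -> : Y * S - S * Y = Y * (S - s n) - (S - s n) * Y.
    by rewrite mulrBr mulrBl (scomm n Y YX) opprB [RHS]addrA subrK.
  by rewrite mulrDr; apply: bdB; [rewrite mulrC|]; apply: bdM.
have Ssa : selfadj S.
  apply/eqP; rewrite -subr_eq0; apply/eqP.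
  apply: (@bd_seq_small (1 + 1)) => // n.
  have -> : op_star S - S = op_star (S - s n) - (S - s n).
    by rewrite op_starD op_starN ssa opprB addrA subrK.
  by rewrite mulrDr mulr1; apply: bdB => //; apply: bd_star.
have S1 : bd 1 S.
  apply: bd_closed => e e0; have [n /ltW ne] := small_invS e0.
  rewrite -(subrK (s n) S) addrC; apply: bdD.
    by apply: le_bounded_by (SP n).
  by apply: le_bounded_by (sb n); have [] := t01 n.
exists S; split=> //; apply/eqP; rewrite -subr_eq0; apply/eqP.
(* Since [X + s_n^2 = 2 s_(n+1)], the residual consists of four error terms: two in [S - s n] and
   twice [S - s n.+1]. *)
apply: (@bd_seq_small (1 + 1 + (1 + 1))) => // n.
have -> : X + S * S - (S + S) = S * (S - s n) + (S - s n) * s n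
    - ((S - s n.+1) + (S - s n.+1)).
  rewrite [in RHS]addrACA -opprD sS mulrBr mulrBl [S * _ - _ + _]addrA subrK.
  by rewrite opprB opprD !addrA; congr (_ - _ - _); rewrite [RHS]addrAC subrK addrC.
rewrite mulrDr mulr2n; apply: bdB.
  rewrite mulrDr mulr1; apply: bdD.
    by rewrite -[X in bd X]mul1r; apply: bdM.
  rewrite -[X in bd X]mulr1; apply: bdM => //.
  by apply: le_bounded_by (sb n); have [] := t01 n.
by rewrite mulrDr mulr1; apply: bdD; apply: le_bounded_by (SP n.+1).
Qed.

End OpBounds.

(** * Positivity *)

Section Positivity.
Variables (R : realType) (B : cstarAlgType R).
Implicit Types (f g h j k n s u y z T S : op B) (x : B) (M N r : R).

Notation bd := (@bounded_by R B).
Notation scal r := (r%:C *: (1 : op B)).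

(** For self-adjoint [f] this says that the spectrum lies in [[0, 2r]], without mentioning spectra.
    Sums are then immediate, and the work lies in [pos_sq] and [pos_starM]. *)
Definition pos f := selfadj f /\ exists2 r, 0 < r & bd r (scal r - f).

Lemma posD f g : pos f -> pos g -> pos (f + g).
Proof.
move=> [sf [r r0 fr]] [sg [t t0 gt]]; split; first exact: selfadjD.
exists (r + t); first exact: addr_gt0.
rewrite rmorphD scalerDl opprD addrACA; exact: bdD.
Qed.

Lemma pos0 : pos 0.
Proof.
split; first exact: selfadj0.
by exists 1 => //; rewrite subr0 scale1r; exact: bd1.
Qed.

Lemma posZ r f : 0 <= r -> pos f -> pos (r%:C *: f).
Proof.
rewrite le_eqVlt => /predU1P[<- _|r0 [sf [t t0 ft]]].
  by rewrite scale0r; exact: pos0.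
split; first exact: selfadjZ.
exists (r * t); first exact: mulr_gt0.
rewrite rmorphM -scalerA -scalerBr -{1}(gtr0_norm r0); exact: bdZ.
Qed.

Lemma pos_half f : pos (f + f) -> pos f.
Proof.
move=> /(posZ (_ : 0 <= 2^-1)) ff; suff <- : (2^-1 : R)%:C *: (f + f) = f by exact: ff.
by rewrite scalerDr -scalerDl -rmorphD /= (_ : _ + _ = 1) ?scale1r//; lra.
Qed.

Lemma pos_scal_sub M f : 0 < M -> selfadj f -> bd M f -> pos (scal M - f).
Proof.
move=> M0 sf fM; split; first by apply: selfadjB => //; apply: selfadjZ; exact: selfadj1.
by exists M => //; rewrite subKr.
Qed.

(** The operator [u = f + 'i g] satisfies [u^* u = f^2 + g^2 = M^2], hence is bounded by [M]; [f] is
    its real part. *)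
Lemma bd_sum_sq M f g : 0 <= M -> selfadj f -> selfadj g -> GRing.comm f g ->
  f * f + g * g = scal (M ^+ 2) -> bd M f.
Proof.
move=> M0 sf sg fg fgM.
have us : op_star (f + 'i *: g) = f - 'i *: g.
  by rewrite op_starD op_starZ sf sg conjCi scaleNr.
have uM : bd M (f + 'i *: g).
  apply: bd_starM => //; rewrite us.
  have -> : (f - 'i *: g) * (f + 'i *: g) = scal (M ^+ 2).
    rewrite mulrDr !mulrBl !opZl !opZr scalerA -(expr2 'i) sqrCi scaleN1r.
    by rewrite -fg -fgM; nc_ring.
  by apply: bd_scal; rewrite exprn_ge0.
apply: bd_double; have := bdD uM (bd_star M0 uM).
by rewrite us addrACA subrr addr0.
Qed.

(** Double angle formulas: with [c = 1 - s] a square root of [1 - h^2], the squares of [2 h c] and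
    [1 - 2 h^2] add up to 1. Hence [1 - 2 h^2] is bounded by 1, and so is its mean with 1. *)
Lemma bd_one_sub_sq h : selfadj h -> bd 1 h -> bd 1 (1 - h * h).
Proof.
move=> sh h1.
have sX : selfadj (h * h) by exact: selfadjM.
have X1 : bd 1 (h * h) by rewrite -[1](mulr1 1); exact: bdM.
have [s [ss s1 Xs scomm]] := sqrt_iteration sX X1.
have hs : GRing.comm h s by apply: scomm; exact: commrM.
(* An opaque name with an equation, so that [nc_ring] sees an atom; the device recurs below. *)
have [c cE] : exists c, c = 1 - s by exists (1 - s).
have sc : selfadj c by rewrite cE; apply: selfadjB => //; exact: selfadj1.
have cc : c * c = 1 - h * h.
  have -> : c * c = 1 - (s + s) + s * s by rewrite cE; nc_ring.
  by rewrite -Xs; nc_ring.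
have hc : GRing.comm h c by rewrite cE; apply: commrB => //; exact: commr1.
have comX Y : GRing.comm Y (h * h) -> GRing.comm (1 - (h * h + h * h)) Y.
  by move=> YX; apply/commr_sym/commrB; [exact: commr1 | exact: commrD].
have hX : GRing.comm (1 - (h * h + h * h)) h by apply/comX/commrM.
have cX : GRing.comm (1 - (h * h + h * h)) c.
  by apply/comX/commrM; exact: commr_sym.
have e1 : bd 1 (1 - (h * h + h * h)).
  apply: (@bd_sum_sq _ _ (h * c + h * c)) => //.
  - by apply: selfadjB; [exact: selfadj1 | exact: selfadjD].
  - by apply: selfadjD; exact: selfadjM.
  - by apply: commrD; apply: commrM.
  have -> : (h * c + h * c) * (h * c + h * c)
      = h * (c * h) * c + h * (c * h) * c + (h * (c * h) * c + h * (c * h) * c) by nc_ring.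
  rewrite -hc.
  have -> : h * (h * c) * c = h * h * (c * c) by nc_ring.
  rewrite cc.
  by rewrite expr1n scale1r; nc_ring.
apply: bd_double.
have -> : 1 - h * h + (1 - h * h) = 1 + (1 - (h * h + h * h)) by nc_ring.
by apply: bdD => //; exact: bd1.
Qed.

(** Rescaling reduces to a bound 1, where [bd_one_sub_sq] applies. *)
Lemma pos_sq h : selfadj h -> pos (h * h).
Proof.
move=> sh; split; first exact: selfadjM.
have [M M0 hM] := op_bounded h; have N0 : 0 < M + 1 by rewrite ltr_wpDl.
move: (M + 1) (lerDl M 1) N0 => N; rewrite ler01 => MN N0.
pose k := N^-1%:C *: h.
have k1 : bd 1 k.
  apply: (@le_bounded_by _ _ (`|N^-1| * M)); last exact: bdZ.
  by rewrite ger0_norm ?invr_ge0 ?(ltW N0)// mulrC ler_pdivrMr// mul1r.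
have N1 : N != 0 by rewrite gt_eqF.
have NP : 0 < N ^+ 2 by rewrite exprn_gt0.
exists (N ^+ 2) => //; have := bdZ (N ^+ 2) (bd_one_sub_sq (selfadjZ _ sh) k1).
rewrite gtr0_norm// mulr1 scalerBr opZl opZr !scalerA -!rmorphM /=.
by rewrite (_ : _ * (_ * _) = 1 :> R) ?scale1r//; field.
Qed.

(** The iteration is run on [X = 1 - T / r], which is bounded by 1; its limit [s] satisfies
    [(1 - s)^2 = 1 - X = T / r]. *)
Lemma pos_sqrt T : pos T ->
  exists S, [/\ selfadj S, S * S = T, pos S &
    forall Y, GRing.comm Y T -> GRing.comm Y S].
Proof.
move=> [sT [r r0 rT]].
have [X XE] : exists X, X = 1 - r^-1%:C *: T by exists (1 - r^-1%:C *: T).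
have sX : selfadj X by rewrite XE; apply: selfadjB; [exact: selfadj1 | exact: selfadjZ].
have X1 : bd 1 X.
  have := bdZ r^-1 rT; rewrite gtr0_norm ?invr_gt0// mulVf ?gt_eqF//.
  by rewrite scalerBr scalerA -rmorphM mulVf ?gt_eqF// scale1r -XE.
have [s [ss s1 Xs scomm]] := sqrt_iteration sX X1.
have sr0 : 0 < Num.sqrt r by rewrite sqrtr_gt0.
exists ((Num.sqrt r)%:C *: (1 - s)); split.
- by apply: selfadjZ; apply: selfadjB => //; exact: selfadj1.
- rewrite opZl opZr scalerA -rmorphM -expr2 sqr_sqrtr ?(ltW r0)//.
  have -> : (1 - s) * (1 - s) = 1 - (s + s) + s * s by nc_ring.
  have -> : 1 - (s + s) + s * s = 1 - X by rewrite -Xs; nc_ring.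
  by rewrite XE subKr scalerA -rmorphM divff ?gt_eqF// scale1r.
- split; first by apply: selfadjZ; apply: selfadjB => //; exact: selfadj1.
  exists (Num.sqrt r) => //; rewrite scalerBr subKr.
  by rewrite -[X in bd X]mulr1 -{1}(gtr0_norm sr0); apply: bdZ.
move=> Y YT; apply: commZ; apply: commrB; first exact: commr1.
by apply: scomm; rewrite XE; apply: commrB; [exact: commr1 | exact: commZ].
Qed.

(** For commuting roots [a] of [M - T] and [b] of [M + T], [T^2] and the square of [a b] add up to
    [M^2]. *)
Lemma bd_between M T : selfadj T -> 0 <= M ->
  pos (scal M - T) -> pos (scal M + T) -> bd M T.
Proof.
move=> sT M0 /pos_sqrt[a [sA aE _ aC]] /pos_sqrt[b [sb bE _ bC]].
have cT r : GRing.comm T (scal r) by apply: commZ; exact: commr1.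
have Ta : GRing.comm T a by apply: aC; apply: commrB.
have Tb : GRing.comm T b by apply: bC; apply: commrD.
have ab : GRing.comm a b.
  apply: bC; apply: commrD; last exact: commr_sym.
  by apply: commZ; exact: commr1.
apply: (@bd_sum_sq _ _ (a * b)) => //; [exact: selfadjM | exact: commrM |].
have -> : a * b * (a * b) = a * (b * a) * b by nc_ring.
rewrite -ab; have -> : a * (a * b) * b = a * a * (b * b) by nc_ring.
rewrite aE bE expr2 rmorphM -scalerA.
have -> : (M%:C *: scal M : op B) = scal M * scal M by rewrite opZl mul1r.
by rewrite mulrBl mulrDr mulrDr -(cT M); nc_ring.
Qed.

Lemma bd_mono M S T : pos S -> pos (T - S) -> 0 <= M -> bd M T -> bd M S.
Proof.
(* The scalar in [pos_scal_sub] must be positive while [M] may be 0; hence the passage to [M + e]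
   below. *)
move=> pS pTS M0 TM; have sT : selfadj T.
  by rewrite -(subrK S T); apply: selfadjD; [case: pTS | case: pS].
apply: bd_closed => e e0; have Me : 0 < M + e by rewrite ltr_wpDl.
apply: bd_between; [by case: pS | exact: ltW | |].
  have -> : scal (M + e) - S = (scal (M + e) - T) + (T - S) by rewrite addrA subrK.
  apply: posD => //; apply: pos_scal_sub => //.
  by apply: le_bounded_by TM; rewrite lerDl ltW.
apply: posD => //; rewrite -[scal _]subr0; apply: pos_scal_sub => //; first exact: selfadj0.
by move=> x; rewrite nrm0 mulr_ge0 ?nrm_ge0 ?ltW.
Qed.

Lemma selfadj_sq0 f : selfadj f -> f * f = 0 -> f = 0.
Proof.
move=> sf ff; apply/bd0/bd_starM => //.
by rewrite sf ff => x; rewrite nrm0 mulr_ge0 ?nrm_ge0.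
Qed.

(* [n] is twice the positive part of [j]. *)
Lemma pos_part j : selfadj j -> exists s n,
  [/\ pos s, n = s + j, selfadj n, pos (n * n * n) & n * j * n + n * j * n = n * n * n].
Proof.
move=> sj; have [s [ss sE ps sC]] := pos_sqrt (pos_sq sj).
have js : GRing.comm j s by apply: sC; exact: commrM.
exists s, (s + j); split=> //; first exact: selfadjD.
  (* From [j^2 = s^2] follow [j n = s n] and [n^2 = 2 s n], so [n^3 = 2 (t n)^2] for a root [t] of
     [s] commuting with [n]. *)
  have [t [st tE _ tC]] := pos_sqrt ps.
  have sn : selfadj (s + j) by exact: selfadjD.
  have nt : GRing.comm (s + j) t.
    by apply: tC; apply/commr_sym/commrD => //; exact: commr_sym.
  have -> : (s + j) * (s + j) * (s + j)
      = t * (s + j) * (t * (s + j)) + t * (s + j) * (t * (s + j)).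
    have -> : t * (s + j) * (t * (s + j)) = s * ((s + j) * (s + j)).
      have -> : t * (s + j) * (t * (s + j)) = t * ((s + j) * t) * (s + j) by nc_ring.
      by rewrite nt -tE; nc_ring.
    have -> : (s + j) * (s + j) * (s + j) = (s * s + s * j + j * s + j * j) * (s + j) by nc_ring.
    by rewrite -sE js; nc_ring.
  by apply: posD; apply: pos_sq; apply: selfadjM => //; exact: commr_sym.
have -> : (s + j) * (s + j) * (s + j) = (s + j) * (s * s + s * j + j * s + j * j) by nc_ring.
by rewrite sE -js; nc_ring.
Qed.

(** With [p = - z^* z] and [q = z z^*], positivity of [p] forces that of [q]. The relation
    [(1 + q) z = z (1 - p)] replaces a comparison of spectra: it turns [(1 + q)^2 q] into
    [z (1 - p)^2 z^*], which is bounded by 1 and dominates [2 q^2]. *)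
Lemma bd_neg_starM z : pos (- (op_star z * z)) -> bd 1 z -> bd (9 / 10) z.
Proof.
move=> pz z1.
have z1' : bd 1 (op_star z) by exact: bd_star.
have [p pE] : exists p, p = - (op_star z * z) by exists (- (op_star z * z)).
have [q qE] : exists q, q = z * op_star z by exists (z * op_star z).
have sq : selfadj q by rewrite qE -{1}(op_starK z); exact: selfadj_starM.
(* With y the adjoint of z, zy + yz is half the sum of the squares of z + y
   and 'i (z - y). *)
have pq : pos q.
  have [a aE] : exists a, a = z + op_star z by exists (z + op_star z).
  have [b bE] : exists b, b = 'i *: (z - op_star z) by exists ('i *: (z - op_star z)).
  have sa_a : selfadj a by rewrite aE /selfadj op_starD op_starK addrC.
  have sb : selfadj b.
    by rewrite bE /selfadj op_starZ op_starD op_starN op_starK conjCi scaleNr -scalerN opprB.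
  apply: pos_half.
  have -> : q + q = a * a + b * b + (p + p).
    rewrite bE opZl opZr scalerA -(expr2 'i) sqrCi scaleN1r aE pE qE; nc_ring.
  by rewrite -pE in pz; apply: posD; apply: posD => //; exact: pos_sq.
have p1 : bd 1 (1 - p).
  have [d [sd dE _ _]] := pos_sqrt pz; rewrite pE -dE; apply: bd_one_sub_sq => //.
  apply: bd_starM => //; rewrite sd dE expr1n => x; rewrite opE nrmN.
  by rewrite -[1](mulr1 1); apply: bdM.
have qz : (1 + q) * z = z * (1 - p) by rewrite qE pE; nc_ring.
have q21 : bd 1 ((1 + q) * (1 + q) * q).
  have -> : (1 + q) * (1 + q) * q = (1 + q) * ((1 + q) * z) * op_star z.
    by rewrite {3}qE; nc_ring.
  rewrite qz; have -> : (1 + q) * (z * (1 - p)) = (1 + q) * z * (1 - p) by nc_ring.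
  rewrite qz -[1](mulr1 1) -{1}[1](mulr1 1) -{1}[1](mulr1 1).
  by do 3 (apply: bdM => //).
have q2 : bd (1 / 2 + 1 / 2) (q * q + q * q).
  apply: (bd_mono (T := (1 + q) * (1 + q) * q)) => //; last 1 first.
  - by rewrite -splitr.
  - by apply: posD; apply: pos_sq.
  have [h [sh hE _ _]] := pos_sqrt pq.
  have -> : (1 + q) * (1 + q) * q - (q * q + q * q) = q + h * h * h * (h * h * h).
    by rewrite -hE; nc_ring.
  apply: posD => //; apply: pos_sq; rewrite hE; apply: selfadjM => //; rewrite -hE.
  by apply/commr_sym/commrM.
(* The constant only needs to be below 1 with fourth power at least 1/2, the bound on [q^2]. *)
have {}q2 : bd ((9 / 10) ^+ 2) q.
  apply: bd_starM; first exact: exprn_ge0; rewrite sq.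
  by apply: le_bounded_by (bd_double q2); lra.
rewrite -(op_starK z); apply: bd_star => //; apply: bd_starM => //.
by rewrite op_starK -qE.
Qed.

(** By homogeneity [bd_neg_starM] improves every bound of [z] by the factor 9/10. *)
Lemma neg_starM_eq0 z : pos (- (op_star z * z)) -> z = 0.
Proof.
move=> pz; apply: (@bd_shrink _ _ (9 / 10)) => [||M M0 zM]; [lra | lra |].
have [M1|M1] := eqVneq M 0.
  by rewrite M1 mulr0; rewrite M1 in zM.
have {M1}M0 : 0 < M by rewrite lt_def M1.
have Mz : bd 1 (M^-1%:C *: z).
  by have := bdZ M^-1 zM; rewrite gtr0_norm ?invr_gt0// mulVf ?gt_eqF.
have Mp : pos (- (op_star (M^-1%:C *: z) * (M^-1%:C *: z))).
  rewrite op_starZ opZl opZr conj_Creal ?complex_real// scalerA -rmorphM -scalerN.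
  by apply: posZ => //; rewrite mulr_ge0 ?invr_ge0 ?ltW.
have := bdZ M (bd_neg_starM Mp Mz).
by rewrite scalerA -rmorphM divff ?gt_eqF// scale1r gtr0_norm// mulrC.
Qed.

(** Let [n] be twice the positive part of [- k], where [k = y^* y]. Then [n^3 = - 2 (y n)^* (y n)]
    is positive, so [y n = 0] by [neg_starM_eq0]; thus [n = 0] and [k] equals the positive [s]. *)
Lemma pos_starM y : pos (op_star y * y).
Proof.
have [k kE] : exists k, k = op_star y * y by exists (op_star y * y).
have sk : selfadj k by rewrite kE; exact: selfadj_starM.
have [s [n [ps nE sn n3 nk]]] := pos_part (selfadjN sk).
have yn : y * n = 0.
  apply: neg_starM_eq0; apply: pos_half.
  have -> : - (op_star (y * n) * (y * n)) + - (op_star (y * n) * (y * n)) = n * n * n.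
    by rewrite op_starM sn -nk kE; nc_ring.
  exact: n3.
have nn : n * n * n = 0.
  have -> : n * n * n = - (n * op_star y * (y * n) + n * op_star y * (y * n)).
    by rewrite -nk kE; nc_ring.
  by rewrite yn; nc_ring.
have n0 : n = 0.
  apply: selfadj_sq0 => //; apply: selfadj_sq0; first exact: selfadjM.
  have -> : n * n * (n * n) = n * n * n * n by nc_ring.
  by rewrite nn mul0r.
by rewrite -kE -[k]addr0 -n0 nE [k + _]addrC subrK.
Qed.

Lemma pos_conj T n : pos T -> selfadj n -> pos (n * T * n).
Proof.
move=> /pos_sqrt[S [sS <- _ _]] sn.
have -> : n * (S * S) * n = op_star (S * n) * (S * n) by rewrite op_starM sn sS; nc_ring.
exact: pos_starM.
Qed.

(* Testing the hypothesis on the range of n = (g^* g - 2r)_+, where g^* g >= 2r,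
   shows that n q^* q n dominates (1 + t) n u^* u n for some t > 0, although its
   norm is not larger than that of n u^* u n. *)
Lemma bd_starM_of_domination q u g W r : 0 < r -> selfadj W -> bd r W ->
  op_star q * q = op_star u * u + op_star g * g - W ->
  (forall x, nrm (q x) <= nrm (u x)) -> bd (r + r) (op_star g * g).
Proof.
move=> r0 sW Wr quE qu.
have [H HE] : exists H, H = op_star g * g by exists (op_star g * g).
have [P PE] : exists P, P = op_star u * u by exists (op_star u * u).
have [rho rhoE] : exists rho, rho = scal r by exists (scal r).
have srho : selfadj rho by rewrite rhoE; apply: selfadjZ; exact: selfadj1.
have crho n : n * rho = rho * n by rewrite rhoE opZl opZr mulr1 mul1r.
have sH : selfadj H by rewrite HE; exact: selfadj_starM.
have sP : selfadj P by rewrite PE; exact: selfadj_starM.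
have [s [n [ps nE sn n3 nj]]] : exists s n, [/\ pos s, n = s + (H - (rho + rho)),
    selfadj n, pos (n * n * n) &
    n * (H - (rho + rho)) * n + n * (H - (rho + rho)) * n = n * n * n].
  by apply: pos_part; apply: selfadjB => //; exact: selfadjD.
have pnn : pos (r%:C *: (n * n)) by apply: posZ; [exact: ltW | exact: pos_sq].
have nrhon : n * rho * n = r%:C *: (n * n) by rewrite rhoE opZr opZl mulr1.
have Wpos : pos (n * (rho - W) * n).
  by apply: pos_conj => //; rewrite rhoE; exact: pos_scal_sub.
(* This is [n (H - 2 rho) n], which is half of [n^3], plus [n (rho - W) n]. *)
have dom : pos (n * (op_star q * q) * n - n * P * n - r%:C *: (n * n)).
  rewrite quE -HE -PE -nrhon; apply: pos_half.
  have -> : n * (P + H - W) * n - n * P * n - n * rho * n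
      + (n * (P + H - W) * n - n * P * n - n * rho * n)
    = n * n * n + (n * (rho - W) * n + n * (rho - W) * n) by rewrite -nj; nc_ring.
  by apply: posD => //; exact: posD.
have [L L0 PL] := op_bounded P.
have L1 : 0 < L + 1 by rewrite ltr_wpDl.
have PLpos : pos ((L + 1)%:C *: (n * n) - n * P * n).
  have -> : (L + 1)%:C *: (n * n) - n * P * n = n * (scal (L + 1) - P) * n.
    by rewrite mulrBr mulrBl opZr opZl mulr1.
  apply: pos_conj => //; apply: pos_scal_sub => //.
  by apply: le_bounded_by PL; rewrite lerDl.
(* Since [P <= L + 1], this [t] makes [r n^2] dominate [t n P n]. *)
have [t t0 tL] : exists2 t, 0 < t & t * (L + 1) = r.
  by exists (r / (L + 1)); rewrite ?divr_gt0// divfK ?gt_eqF.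
have dom' : pos (n * (op_star q * q) * n - (1 + t)%:C *: (n * P * n)).
  have := posD dom (posZ (ltW t0) PLpos).
  rewrite scalerBr scalerA -rmorphM tL rmorphD scalerDl scale1r.
  by rewrite addrA subrK opprD addrA.
(* The norm hypothesis [qu] enters here, evaluated on the range of [n]. *)
have qb M : 0 <= M -> bd M (n * P * n) -> bd M (n * (op_star q * q) * n).
  move=> M0 nPn; have s0 : 0 <= Num.sqrt M by exact: sqrtr_ge0.
  have un : bd (Num.sqrt M) (u * n).
    apply: bd_starM => //; rewrite sqr_sqrtr// op_starM sn.
    by have -> : n * op_star u * (u * n) = n * P * n by rewrite PE; nc_ring.
  have qn : bd (Num.sqrt M) (q * n) by move=> x; exact: le_trans (qu _) (un x).
  have -> : n * (op_star q * q) * n = op_star (q * n) * (q * n).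
    by rewrite op_starM sn; nc_ring.
  by rewrite -(sqr_sqrtr M0) expr2; apply: bdM => //; exact: bd_star.
have nPn0 : n * P * n = 0.
  have t1 : 0 < 1 + t by rewrite addr_gt0.
  apply: (@bd_shrink _ _ (1 + t)^-1).
  - by rewrite invr_ge0 ltW.
  - by rewrite invf_lt1// ltrDl.
  move=> M M0 nPM.
  have pt : pos ((1 + t)%:C *: (n * P * n)).
    by apply: posZ; [exact: ltW | apply: pos_conj => //; rewrite PE; exact: pos_starM].
  have := bdZ (1 + t)^-1 (bd_mono pt dom' M0 (qb M M0 nPM)).
  by rewrite scalerA -rmorphM mulVf ?gt_eqF// scale1r ger0_norm// invr_ge0 ltW.
have nqn0 : n * (op_star q * q) * n = 0.
  by apply/bd0/qb => //; rewrite nPn0 => x; rewrite nrm0 mul0r.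
have nn0 : n * n = 0.
  have b0 : bd 0 (r%:C *: (n * n)).
    apply: (bd_mono pnn _ (lexx 0) (T := 0)); last by move=> x; rewrite nrm0 mul0r.
    by move: dom; rewrite nqn0 nPn0 subr0.
  have /eqP := bd0 b0; rewrite scaler_eq0 => /orP[|/eqP//].
  by rewrite (inj_eq (@complexI _) r 0) gt_eqF.
have n0 : n = 0 by exact: selfadj_sq0.
have sE : scal (r + r) - H = s.
  rewrite rmorphD scalerDl -rhoE; move/esym/eqP: nE.
  by rewrite n0 addr_eq0 opprB => /eqP->.
rewrite -HE; apply: (bd_mono (T := scal (r + r))).
- by rewrite HE; exact: pos_starM.
- by rewrite sE.
- by rewrite addr_ge0 ?ltW.
- by apply: bd_scal; rewrite addr_ge0 ?ltW.
Qed.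

End Positivity.

(** * The left regular representation *)

Section LeftMultiplication.
Variables (R : realType) (B : cstarAlgType R).
Implicit Types (a b x : B).

Lemma LopM a b : Lop (csmul a b) = Lop a * Lop b.
Proof. by apply/op_eqP => x; rewrite /= /lmul csmulA. Qed.

Lemma LopD a b : Lop (a + b) = Lop a + Lop b.
Proof. by apply/op_eqP => x; rewrite opE /= /lmul csmulDl. Qed.

Lemma LopN a : Lop (- a) = - Lop a.
Proof.
apply/op_eqP => x; rewrite opE /= /lmul; apply/eqP.
by rewrite -addr_eq0 -csmulDl addNr csmul0l.
Qed.

(** The adjoint of [a] serves as test vector in place of a unit: [|a a^*| = |a|^2]. *)
Lemma bd_Lop (M : R) a : 0 <= M -> bounded_by M (Lop a) -> nrm a <= M.
Proof.
move=> M0 aM; have [->//|a0] := eqVneq (nrm a) 0.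
have a1 : 0 < nrm a by rewrite lt_def a0 nrm_ge0.
rewrite -(ler_pM2r a1) -{3}(nrm_csstar a) (le_trans _ (aM _))//.
by rewrite -expr2 -(nrm_csstar a) -nrm_bip /bip csstarK.
Qed.

(** Lets additive identities in [B] be checked by [nc_ring] in the unital ring of operators. *)
Lemma Lop_inj a b : Lop a = Lop b -> a = b.
Proof.
move=> ab; apply/eqP; rewrite -subr_eq0; apply/eqP/nrm_eq0/eqP.
rewrite eq_le nrm_ge0 andbT; apply: bd_Lop => // x.
by rewrite LopD LopN ab subrr nrm0 mul0r.
Qed.

End LeftMultiplication.

(** * Right linear contractions of Hilbert modules *)

Section HilbertModuleBasics.
Variables (R : realType) (B : cstarAlgType R) (E : hilbertModType B).
Implicit Types (x y z : E) (a b : B).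

Lemma hmipDl x y z : hmip (y + z) x = hmip y x + hmip z x.
Proof. by rewrite -hmip_star hmipDr csstarD !hmip_star. Qed.

Lemma hmip0r x : hmip x 0 = 0 :> B.
Proof. by apply: (addrI (hmip x 0)); rewrite -hmipDr !addr0. Qed.

Lemma hmipNr x y : hmip x (- y) = - hmip x y.
Proof. by apply/eqP; rewrite -addr_eq0 -hmipDr addNr hmip0r. Qed.

Lemma hmipNl x y : hmip (- x) y = - hmip x y.
Proof. by rewrite -hmip_star hmipNr csstarN hmip_star. Qed.

Lemma hmipZl (k : R[i]) x y : hmip (k *: x) y = k^* *: hmip x y.
Proof. by rewrite -hmip_star hmipZr csstarZ hmip_star. Qed.

Lemma hmip_actl x y a : hmip (hmact x a) y = csmul (csstar a) (hmip x y).
Proof. by rewrite -hmip_star hmip_act csstarM hmip_star. Qed.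

Lemma hmip_injr y z : (forall x, hmip x y = hmip x z) -> y = z.
Proof.
move=> yz; apply/eqP; rewrite -subr_eq0; apply/eqP/hmip_def.
by rewrite hmipDr hmipNr yz subrr.
Qed.

Lemma nrm_hmip x : nrm (hmip x x) = nrm x ^+ 2.
Proof. by apply: complexI; rewrite rmorphXn /= -!nrmE hmnorm. Qed.

Lemma hmip_subZ (t : R) x y : hmip (x - t%:C *: y) (x - t%:C *: y) =
  hmip x x - t%:C *: hmip x y - (t%:C *: hmip y x - t%:C *: (t%:C *: hmip y y)).
Proof.
rewrite hmipDl !hmipDr !(hmipNl, hmipNr) !(hmipZl, hmipZr).
by rewrite conj_Creal ?complex_real// opprD.
Qed.

Lemma selfadjoint_right_linear (p : E -> E) : adjoint_pair p p -> right_linear p.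
Proof.
move=> pp; split=> [k x y|x b]; apply: hmip_injr => z.
  by rewrite hmipDr hmipZr -!pp hmipDr hmipZr.
by rewrite -pp !hmip_act pp.
Qed.

(** From [q p = p] one gets [<p x, y> = <p x, p y>], which is symmetric in [x] and [y]; so [p] is
    its own adjoint. *)
Lemma projectionP (p : E -> E) :
  projection p <-> adjoint_pair p p /\ p \o p = p.
Proof.
split=> [[q pq qp]|[pp pE]]; last by exists p.
have pp : adjoint_pair p p.
  move=> x y; rewrite -[in LHS]qp /=.
  by rewrite -hmip_star -[in LHS]pq hmip_star pq -[q (p y)]/((q \o p) y) qp.
split=> //; apply/funext => x; apply: hmip_injr => z /=.
by rewrite -pp pq -[q (p x)]/((q \o p) x) qp.
Qed.

(* [2 p - 1] preserves inner products. *)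
Lemma nrm_projection (p : E -> E) x : projection p -> nrm (p x) <= nrm x.
Proof.
move=> /projectionP[pp pE].
have px y z : hmip (p y) (p z) = hmip y (p z) by rewrite pp -[p (p z)]/((p \o p) z) pE.
have w0 : hmip (p x - x) (p x) = 0 by rewrite hmipDl hmipNl px subrr.
have w0' : hmip (p x) (p x - x) = 0 by rewrite -hmip_star w0 csstar0.
have ux : nrm (p x + (p x - x)) = nrm x.
  apply/eqP; rewrite -(eqrXn2 (ltn0Sn 1)) ?nrm_ge0// -!nrm_hmip; apply/eqP; congr nrm.
  rewrite hmipDl (hmipDr (p x)) w0' addr0 !(hmipDr (p x - x)) w0 !add0r hmipNr px.
  by rewrite hmipDl hmipNl pp opprD opprK addrA subrr add0r.
have -> : p x = (2^-1 : R)%:C *: ((p x + (p x - x)) + x).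
  rewrite -addrA subrK scalerDr -scalerDl -rmorphD /= (_ : _ + _ = 1) ?scale1r//.
  by lra.
rewrite nrmZ ger0_norm//; have := nrmD (p x + (p x - x)) x; rewrite ux; lra.
Qed.

End HilbertModuleBasics.

(** * Inner products with isometric vectors *)

Section RightLinearContractions.
Variables (R : realType) (B : cstarAlgType R) (E F : hilbertModType B).
Variable (c : E -> F).
Hypotheses (c_lin : right_linear c) (c_contr : contractive c).

(** Translates contractivity into [B]: if [<c w, c w> = b^* b] and [<w, w> = a^* a], right linearity
    gives [|b x| = |c (w x)| <= |w x| = |a x|] for all [x] in [B], the norm domination required by
    [bd_starM_of_domination]. *)
Lemma contraction_defect_bound (w : E) (g W : B) (r : R) : 0 < r ->
  hmip (c w) (c w) = hmip w w + csmul (csstar g) g - W -> nrm W <= r ->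
  nrm (csmul (csstar g) g) <= r + r.
Proof.
move=> r0 cw Wr; have [b bE] := hmip_pos (c w); have [a aE] := hmip_pos w.
have cstarM_sa d : csstar (csmul (csstar d) d) = csmul (csstar d) d.
  by rewrite csstarM csstarK.
have WE : W = hmip w w + csmul (csstar g) g - hmip (c w) (c w) by rewrite cw subKr.
apply: bd_Lop; first by rewrite addr_ge0 ?ltW.
rewrite LopM -op_starL; apply: (@bd_starM_of_domination _ _ (Lop b) (Lop a) _ (Lop W)) => //.
- by rewrite /selfadj op_starL WE csstarD csstarN csstarD !hmip_star cstarM_sa.
- move=> x; rewrite (le_trans (nrm_csmul _ _))// ler_wpM2r ?nrm_ge0//.
- by rewrite !op_starL -!LopM -LopN -!LopD -bE -aE cw.
have nE d (G : hilbertModType B) (y : G) x : hmip y y = csmul (csstar d) d ->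
    nrm (Lop d x) = nrm (hmact y x).
  move=> yd; apply/eqP; rewrite -(eqrXn2 (ltn0Sn 1)) ?nrm_ge0//.
  rewrite -nrm_hmip -nrm_bip; apply/eqP; congr nrm.
  by rewrite hmip_act hmip_actl yd /bip /= /lmul csstarM !csmulA.
move=> x; rewrite (nE _ _ _ _ bE) (nE _ _ _ _ aE) -c_lin.2.
by rewrite -lecR -!nrmE c_contr.
Qed.

(* The defect form <x,y> - <cx,cy> satisfies a Cauchy-Schwarz inequality: apply
   [contraction_defect_bound] to z - s y G for G the defect of y, z and s large. *)
Lemma isometric_part_ip (y z : E) : isometric_part c y ->
  hmip (c y) (c z) = hmip y z.
Proof.
rewrite /isometric_part /= => cy.
have [G GE] : exists G, G = hmip y z - hmip (c y) (c z) by eexists.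
have yz : hmip y z = hmip (c y) (c z) + G by rewrite GE addrC subrK.
pose v := hmact y G; pose W := hmip z z - hmip (c z) (c z).
have vv : hmip v v = hmip (c v) (c v) by rewrite c_lin.2 !(hmip_act, hmip_actl) cy.
have vz : hmip v z = hmip (c v) (c z) + csmul (csstar G) G.
  by rewrite c_lin.2 !hmip_actl -csmulDr -yz.
have zv : hmip z v = hmip (c z) (c v) + csmul (csstar G) G.
  by rewrite -hmip_star vz csstarD hmip_star csstarM csstarK.
(* The bound does not depend on [t]; the added 1 makes it positive, as [contraction_defect_bound]
   requires. *)
have key (t : R) : t ^+ 2 * nrm (csmul (csstar G) G) <= (nrm W + 1) + (nrm W + 1).
  have W1 : 0 < nrm W + 1 by rewrite ltr_wpDl ?nrm_ge0.
  rewrite -[t ^+ 2]ger0_norm ?sqr_ge0// -nrmZ.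
  have GG : (t ^+ 2)%:C *: csmul (csstar G) G = csmul (csstar (t%:C *: G)) (t%:C *: G).
    by rewrite csstarZ csmulZl csmulZr conj_Creal ?complex_real// scalerA -rmorphM.
  (* With [h = t^2 / 2] the two cross terms together contribute [t^2 G^* G]. *)
  have [h hE] : exists h, t ^+ 2 = h + h by exists (t ^+ 2 / 2); exact: splitr.
  rewrite GG; apply: (@contraction_defect_bound (z - h%:C *: v) _ W) => //.
    have -> : c (z - h%:C *: v) = c z - h%:C *: c v.
      by rewrite -scaleNr addrC c_lin.1 addrC scaleNr.
    rewrite -GG hE rmorphD scalerDl !hmip_subZ vv vz zv !scalerDr.
    by rewrite /W; apply: Lop_inj; rewrite !(LopD, LopN); nc_ring.
  by rewrite lerDl.
suff /eqP : nrm (csmul (csstar G) G) = 0.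
  by rewrite nrm_bip expf_eq0 /= => /eqP/nrm_eq0/eqP; rewrite GE subr_eq0 => /eqP.
apply/eqP; rewrite eq_le nrm_ge0 andbT leNgt; apply/negP => n0.
have := nrm_ge0 W; move: (nrm _) (nrm W) n0 key => n w n0 key w0.
(* This value exceeds both 1 and [2 (w + 1) / n], up to equality with 1 excluded by [w >= 0]; so its
   square times [n] exceeds the bound. *)
have := key (2 * (w + 1) / n + 1); apply/negP; rewrite -ltNge.
have q0 : 0 <= 2 * (w + 1) / n by apply: divr_ge0; [lra | exact: ltW].
have : 2 * (w + 1) / n * n = 2 * (w + 1) by rewrite divfK ?gt_eqF.
by move: (_ / n) q0 => q q0; rewrite expr2; nra.
Qed.

End RightLinearContractions.

(** * Initial projections and complemented submodules *)

Section PartialIsometries.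
Variables (R : realType) (B : cstarAlgType R) (E F : hilbertModType B).
Implicit Types (v : E -> F) (p : E -> E).

(** Each [v y] equals [v s] for some [s] on which [v] is isometric, and [isometric_part_ip] gives
    [<v x, v s> = <x, s>] for all [x]. So [s] is the value of the adjoint at [v y], and [xget] does
    not fall back on its default. *)
Lemma initial_projectionP v : partial_isometry v ->
  (forall x y, hmip (v x) (v y) = hmip x (initial_projection v y)) /\
  v \o initial_projection v = v.
Proof.
move=> [_ v_lin v_contr _ [S _ [Siso SE]]].
have vS y : exists s, [/\ S s, v s = v y & forall x, hmip (v x) (v y) = hmip x s].
  have : range v (v y) by exists y.
  rewrite -SE => -[s Ss vs]; exists s; split=> // x.
  rewrite -hmip_star -vs (isometric_part_ip v_lin v_contr) ?hmip_star//.
  exact: Siso.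
have vpi x y : hmip (v x) (v y) = hmip x (initial_projection v y).
  have [s [_ _ sP]] := vS y.
  apply: (xgetPex 0 (P := [set z | forall x, hmip (v x) (v y) = hmip x z])).
  by exists s.
split=> //; apply/funext => y /=; have [s [_ vs sP]] := vS y.
by rewrite -[RHS]vs; congr v; apply: hmip_injr => x; rewrite -vpi.
Qed.

Lemma initial_projection_uniq v p y : partial_isometry v ->
  (forall x, hmip (v x) (v y) = hmip x (p y)) -> initial_projection v y = p y.
Proof.
by move=> /initial_projectionP[vpi _] vp; apply: hmip_injr => x; rewrite -vpi.
Qed.

Lemma initial_projection_projection v :
  partial_isometry v -> projection (initial_projection v).
Proof.
move=> /initial_projectionP[vpi vE]; apply/projectionP; split=> [x y|].
  by rewrite -vpi -hmip_star -vpi hmip_star.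
apply/funext => y; apply: hmip_injr => x /=.
by rewrite -!vpi -[v (initial_projection v y)]/((v \o initial_projection v) y) vE.
Qed.

(** Each projection fixes the range of the other: [p q = q] and [q p = p]. Self-adjointness then
    gives equality. *)
Lemma projection_onto_uniq p q (S : set E) :
  projection_onto p S -> projection_onto q S -> p = q.
Proof.
move=> [/projectionP[pp pE] pS] [/projectionP[qq qE] qS].
have pq x : p (q x) = q x.
  have : range p (q x) by rewrite pS -qS; exists x.
  by move=> [z _ <-]; rewrite -[p (p z)]/((p \o p) z) pE.
have qp x : q (p x) = p x.
  have : range q (p x) by rewrite qS -pS; exists x.
  by move=> [z _ <-]; rewrite -[q (q z)]/((q \o q) z) qE.
by apply/funext => x; apply: hmip_injr => y; rewrite -qp -qq -pp pq qq.
Qed.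

(** Choosing the two components of each vector gives maps [p] and [q]; orthogonality alone makes [p]
    self-adjoint, which includes its linearity. *)
Lemma complementedP (S : set E) :
  complemented S <-> exists p, projection_onto p S.
Proof.
split=> [/choice[p /choice[q pq]]|[p [/projectionP[pp pE] pS]] x]; last first.
  exists (p x), (x - p x); split; last by rewrite addrC subrK.
    by rewrite -pS; exists x.
  rewrite -pS => _ [z _ <-].
  by rewrite hmipDr hmipNr !pp -[p (p x)]/((p \o p) x) pE subrr.
have pS x : S (p x) by have [] := pq x.
have qS x y : S y -> hmip y (q x) = 0 by move=> Sy; have [_ + _] := pq x; apply.
have xE x : x = p x + q x by have [] := pq x.
have pp : adjoint_pair p p.
  move=> x y; rewrite {2}(xE x) {1}(xE y) hmipDr qS // addr0 hmipDl.
  by rewrite -[X in _ = _ + X]hmip_star qS// csstar0 addr0.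
have pid y : S y -> p y = y.
  move=> Sy; apply/esym/eqP; rewrite -subr_eq0; apply/eqP/hmip_def.
  have yq : y - p y = q y by rewrite {1}(xE y) addrAC subrr add0r.
  by rewrite {2}yq hmipDl hmipNl !qS// subrr.
exists p; split.
  by apply/projectionP; split=> //; apply/funext => x /=; rewrite pid.
by apply/seteqP; split=> [_ [x _ <-]//|x Sx]; exists x => //; exact: pid.
Qed.

End PartialIsometries.

(** * The partial isometry contained in a contraction *)

Section ContainedPartialIsometry.
Variables (R : realType) (B : cstarAlgType R) (E F : hilbertModType B).
Variable (c : E -> F).
Hypotheses (c_lin : right_linear c) (c_contr : contractive c).

(** On the range of the initial projection, containment gives [<x, x> <= <c x, c x>], and
    [contraction_defect_bound] with [W = 0] and arbitrarily small [r] forces equality. Conversely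
    [v] agrees with [c] on an isometric vector [x], so [<v z, v x> = <z, x>] and the projection
    fixes [x]. *)
Lemma contained_projection_onto v : contained_partial_isometry c v ->
  projection_onto (initial_projection v) (isometric_part c).
Proof.
move=> [pv [vc vP]]; have prj := initial_projection_projection pv.
split=> //; have /projectionP[pp pE] := prj; have [vpi vE] := initial_projectionP pv.
apply/seteqP; split=> [_ [y _ <-]|x Px].
  have [x xE] : exists x, x = initial_projection v y by eexists.
  have xx : initial_projection v x = x.
    by rewrite xE -[LHS]/((initial_projection v \o initial_projection v) y) pE.
  rewrite -xE /isometric_part /=; have [b bE] := vc x; rewrite xx in bE.
  have cx : hmip (c x) (c x) = hmip x x + csmul (csstar b) b - 0.
    by rewrite -bE subr0 addrC subrK.
  suff b0 : csmul (csstar b) b = 0 by rewrite cx b0 subr0 addr0.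
  apply: (nrm_small (K := 1 + 1)) => e e0; rewrite mulrDr mulr1.
  by apply: (contraction_defect_bound c_lin c_contr e0 cx); rewrite nrm0 ltW.
exists x => //; apply: hmip_injr => z.
apply/esym; rewrite -vpi.
have vx : isometric_part v x by rewrite /isometric_part /= vP.
have [_ v_lin v_contr _ _] := pv.
by rewrite -[LHS]hmip_star -[RHS]hmip_star (isometric_part_ip v_lin v_contr).
Qed.

(** Both maps equal [c] composed with the same projection. *)
Lemma contained_uniq v w : contained_partial_isometry c v ->
  contained_partial_isometry c w -> v = w.
Proof.
move=> cv cw; have pv := contained_projection_onto cv.
have pw := contained_projection_onto cw.
have pvw := projection_onto_uniq pv pw.
case: cv cw => [/initial_projectionP[_ vE] [_ vP]] [/initial_projectionP[_ wE] [_ wP]].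
apply/funext => x; rewrite -vE -wE /= pvw vP ?wP//.
  by case: pw => _ <-; exists x.
by case: pw => _ <-; exists x.
Qed.

(** [c] is isometric on the range of [p], so if [c (p x_n)] converges to [y], then [p x_n] is
    Cauchy; its limit [l] satisfies [c (p l) = y]. *)
Lemma closed_range_isometric p :
  projection_onto p (isometric_part c) -> closed (range (c \o p)).
Proof.
move=> [/[dup] prj /projectionP[pp pE] pS] y cy.
have [p_lin _] := selfadjoint_right_linear pp; have [cl _] := c_lin.
have pD u v : p (u - v) = p u - p v by rewrite -scaleN1r addrC p_lin scaleN1r addrC.
have cD u v : c (u - v) = c u - c v by rewrite -scaleN1r addrC cl scaleN1r addrC.
have xP (n : nat) : exists x, nrm (y - c (p x)) <= n.+2%:R^-1.
  have n0 : (0 : R[i]) < (n.+2%:R^-1 : R)%:C by rewrite -(rmorph0 (real_complex R)) ltcR.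
  have [_ [[x _ <-] +]] := cy _ (nbhsx_ballx y _ n0).
  by rewrite -ball_normE /ball_ /= nrmE ltcR => /ltW xn; exists x.
have [x {}xP] := choice xP.
have cnrm u : nrm (c (p u)) = nrm (p u).
  have : isometric_part c (p u) by rewrite -pS; exists u.
  rewrite /isometric_part /= => cpu.
  by apply/eqP; rewrite -(eqrXn2 (ltn0Sn 1)) ?nrm_ge0// -!nrm_hmip cpu.
have [l lP] : exists l, forall n, nrm (l - p (x n)) <= 2 / n.+2%:R * 1.
  apply: complete_lim => m n nm; rewrite -pD -cnrm pD cD mulr1.
  have -> : c (p (x m)) - c (p (x n)) = (y - c (p (x n))) - (y - c (p (x m))).
    by rewrite opprB [RHS]addrC addrA subrK.
  rewrite (le_trans (nrmD _ _))// nrmN mulr_natl mulr2n lerD//.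
  by rewrite (le_trans (xP m))// lef_pV2 ?posrE// ler_nat.
exists l => //=; apply/eqP; rewrite -subr_eq0; apply/eqP.
apply: (nrm_small (K := 2)) => e e0; have [n /ltW ne] := small_invS e0.
have -> : c (p l) - y = c (p (l - p (x n))) - (y - c (p (x n))).
  by rewrite pD -[p (p _)]/((p \o p) _) pE cD opprB addrA subrK.
rewrite (le_trans (nrmD _ _))// mulr_natr mulr2n lerD//.
  rewrite cnrm (le_trans (nrm_projection _ prj))// (le_trans (lP n))//.
  by rewrite mulr1.
rewrite nrmN (le_trans (xP n))// (le_trans _ ne)// ler_pdivlMr// mulVf//.
by rewrite ler1n.
Qed.

Lemma projection_contained p : projection_onto p (isometric_part c) ->
  contained_partial_isometry c (c \o p).
Proof.
move=> pP; have [/[dup] prj /projectionP[pp pE] pS] := pP.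
have p_lin := selfadjoint_right_linear pp.
have ppx x : p (p x) = p x by rewrite -[LHS]/((p \o p) x) pE.
have Pp x : isometric_part c (p x) by rewrite -pS; exists x.
have cpip x y : hmip (c (p x)) (c (p y)) = hmip x (p y).
  by rewrite (isometric_part_ip c_lin c_contr)// pp ppx.
have v_lin : right_linear (c \o p).
  split=> [k x y|x b] /=; first by rewrite p_lin.1 c_lin.1.
  by rewrite p_lin.2 c_lin.2.
have linS (G H : hilbertModType B) (f : G -> H) : right_linear f -> submodule (range f).
  move=> [fl fa]; have f0 : f 0 = 0.
    by have := fl (-1) 0 0; rewrite scaleN1r oppr0 addr0 scaleN1r addNr.
  split; first by exists 0.
  - by move=> _ _ [x _ <-] [y _ <-]; exists (1 *: x + y); rewrite // fl scale1r.
  - by move=> k _ [x _ <-]; exists (k *: x + 0); rewrite // fl f0 addr0.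
  - by move=> _ b [x _ <-]; exists (hmact x b); rewrite // fa.
have pv : partial_isometry (c \o p).
  split=> //.
  - by split; [exact: linS | exact: closed_range_isometric].
  - move=> x /=; rewrite (le_trans (c_contr _))//.
    by rewrite !nrmE lecR nrm_projection.
  (* [c] is isometric there, and [p] fixes it pointwise. *)
  exists (range p); first exact: linS.
  split=> [_ _ [x _ <-] [y _ <-]|]; first by rewrite /= !ppx cpip pp ppx.
  apply/seteqP; split=> [_ [_ [x _ <-] <-]|_ [x _ <-]]; first by exists (p x).
  by exists (p x); [exists x | rewrite /= ppx].
split=> //; split=> [x|x]; last first.
  by rewrite -{1}pS => -[z _ <-] /=; rewrite ppx.
have -> : initial_projection (c \o p) x = p x.
  by apply: initial_projection_uniq => // y; exact: cpip.
(* The defect [<c x, c x> - <x, p x>] equals [<c z, c z>] for [z = x - p x], because [c (p x)] and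
   [c z] are orthogonal; [b] is a root of this inner product. *)
have [b bE] := hmip_pos (c (x - p x)); exists b; rewrite -bE.
have cz : hmip (c (p x)) (c (x - p x)) = 0.
  by rewrite (isometric_part_ip c_lin c_contr)// hmipDr hmipNr !pp ppx subrr.
have zc : hmip (c (x - p x)) (c (p x)) = 0 by rewrite -hmip_star cz csstar0.
have cx : c x = c (p x) + c (x - p x).
  by rewrite -[c (p x)]scale1r -c_lin.1 scale1r addrC subrK.
by rewrite cx hmipDl !hmipDr cz zc addr0 add0r cpip addrC addKr.
Qed.

End ContainedPartialIsometry.

Theorem theorem3p8 (R : realType) (B : cstarAlgType R)
    (E F : hilbertModType B) (c : E -> F)
    (c_lin : right_linear c) (c_contr : contractive c) :
  [/\ forall v : E -> F, contained_partial_isometry c v ->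
        unique (contained_partial_isometry c) v /\
        projection_onto (initial_projection v) (isometric_part c),
      forall p : E -> E, projection_onto p (isometric_part c) ->
        unique (contained_partial_isometry c) (c \o p)
    & (exists v : E -> F, contained_partial_isometry c v) <->
      complemented (isometric_part c)].
Proof.
have uniq v : contained_partial_isometry c v ->
    unique (contained_partial_isometry c) v.
  by move=> cv; split=> // w cw; exact: (contained_uniq c_lin c_contr cv cw).
split=> [v cv|p pP|].
- by split; [exact: uniq | exact: contained_projection_onto].
- exact/uniq/projection_contained.
rewrite complementedP; split=> [[v cv]|[p pP]].
  by exists (initial_projection v); exact: contained_projection_onto.
by exists (c \o p); exact: projection_contained.
Qed.
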